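(* Let $A$ be a (possibly non-unital) $*$-ring. (1) If every $a\in A\setminus\{0\}$ satisfies $Aa\neq\{0\}$ and $A$ is $\preceq^A$-Blackadar, then $A$ is $\subseteq_\perp$-Blackadar. (2) If $A$ is $\subseteq_\perp$-Blackadar, then $A$ is $\ll$-Blackadar. (3) If for every $a\in A\setminus\{0\}$ there exist $b\in A$ and $c\in A\setminus\{0\}$ with $c\ll b\preceq^A a$, then the following are equivalent: (i) every $a\in A\setminus\{0\}$ satisfies $Aa\neq\{0\}$ and $A$ is $\preceq^A$-Blackadar; (ii) $A$ is $\subseteq_\perp$-Blackadar; (iii) $A$ is $\ll$-Blackadar.
   Context: A $*$-ring is an associative ring with a map $a\mapsto a^*$ satisfying $a^{**}=a$, $(ab)^*=b^*a^*$, $(a+b)^*=a^*+b^*$. $\mathcal{P}=\{p\in A:p=pp^*\}$ is the set of projections. Relations on $A$: $a\preceq^A b\Leftrightarrow a\in Ab=\{xb:x\in A\}$; $a\ll b\Leftrightarrow a=ab$; $a\perp b\Leftrightarrow ab=0$; $a\subseteq_\perp b\Leftrightarrow$ for all $x\in A$, $bx=0$ implies $ax=0$. For a relation $R$ on $A$, $A$ is $R$-Blackadar if $\mathcal{P}\setminus\{0\}$ is $R$-coinitial in $A\setminus\{0\}$, i.e. for every $a\in A\setminus\{0\}$, if there is some $b\in A\setminus\{0\}$ with $b\,R\,a$ then there is some $p\in\mathcal{P}\setminus\{0\}$ with $p\,R\,a$. *)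

(* Defs.v *)
From HB Require Import structures.
From mathcomp Require Import all_boot ssralg.
From mathcomp Require Import boolp classical_sets.

Set Implicit Arguments.
Unset Strict Implicit.
Unset Printing Implicit Defensive.

Import GRing.Theory.

Declare Scope star_ring_scope.
Delimit Scope star_ring_scope with star.
Local Open Scope classical_set_scope.
Local Open Scope ring_scope.
Local Open Scope star_ring_scope.

(* The rings of ssralg all have a unit, so the multiplication of a possibly
   non-unital ring is that of a semigroup, written [(a * b)%g], while the
   additive structure keeps the notations of ring_scope. *)
HB.mixin Record isStarRing A of GRing.Zmodule A & Semigroup A := {
  starmulDl : left_distributive (fun a b : A => (a * b)%g) +%R;
  starmulDr : right_distributive (fun a b : A => (a * b)%g) +%R;
  star : A -> A;
  starK : involutive star;
  starM : forall a b : A, star (a * b)%g = (star b * star a)%g;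
  starD : forall a b : A, star (a + b) = star a + star b
}.

#[short(type="starRingType")]
HB.structure Definition StarRing :=
  { A of isStarRing A & GRing.Zmodule A & Semigroup A }.

Section StarRingRelations.
Variable A : starRingType.
Implicit Types a b p x : A.

Definition projection : set A := [set p | p = (p * star p)%g].

(* This is Ab; as A may lack a unit, b itself need not belong to it. *)
Definition left_multiples b : set A := [set (x * b)%g | x in [set: A]].

Definition preceq a b : Prop := left_multiples b a.

Definition ll a b : Prop := a = (a * b)%g.

Definition perp a b : Prop := (a * b)%g = 0.

(* The right annihilator of b is contained in that of a. *)
Definition subperp a b : Prop := forall x, perp b x -> perp a x.

(* R need not be reflexive or transitive, and elements of C with no R-lower
   bound in C are unconstrained. *)
Definition coinitial (R : A -> A -> Prop) (B C : set A) : Prop :=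
  forall a, C a -> (exists2 b, C b & R b a) -> exists2 p, B p & R p a.

Definition Blackadar (R : A -> A -> Prop) : Prop :=
  coinitial R (projection `\ 0) [set~ 0].

End StarRingRelations.

Notation "a ⪯ b" := (preceq a b) (at level 70, no associativity) : star_ring_scope.
Notation "a ≪ b" := (ll a b) (at level 70, no associativity) : star_ring_scope.

(* Main.v *)
Require Import Defs.
From mathcomp Require Import all_boot ssralg boolp classical_sets.

Local Open Scope classical_set_scope.
Local Open Scope ring_scope.
Local Open Scope star_ring_scope.

(** All three properties ask for a nonzero projection below a given nonzero
    element, and each implication converts one way of being below into another.

    If [p = y * a] then everything killed by [a] on the right is killed by [p],
    so [⪯] refines [subperp]; the nonvanishing of the sets [A a] ensures that
    the coinitiality hypothesis is never vacuous. This is the first statement.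

    For the second one, let [b = b * a] with [b] nonzero. With a unit, [b] would
    annihilate [1 - a], hence so would any projection [p] below [b]. Without a
    unit one only has [b * (x - a * x) = 0] for all [x], which says that
    [p - p * a] annihilates [A] on the right. Such an element must vanish
    ([right_faithful]): a nonzero projection below it would annihilate [A], in
    particular itself, but projections are idempotent.

    Finally, [c ≪ b ⪯ a] yields [c ⪯ a] ([ll_preceq_trans]), so under the
    hypothesis of the third statement a projection [p ≪ b] is one with
    [p ⪯ a], which closes the cycle of implications. *)

Section StarRingTheory.
Variable A : starRingType.
Implicit Types a b c p x : A.

Lemma star_mul0r x : (0 * x)%g = 0 :> A.
Proof. by apply: (GRing.addrI (0 * x)%g); rewrite -starmulDl !GRing.addr0. Qed.

Lemma star_mulr0 x : (x * 0)%g = 0 :> A.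
Proof. by apply: (GRing.addrI (x * 0)%g); rewrite -starmulDr !GRing.addr0. Qed.

Lemma star_mulNr a x : (- a * x)%g = - (a * x)%g :> A.
Proof.
by apply: (GRing.addrI (a * x)%g); rewrite -starmulDl !GRing.subrr star_mul0r.
Qed.

Lemma star_mulrN x a : (x * - a)%g = - (x * a)%g :> A.
Proof.
by apply: (GRing.addrI (x * a)%g); rewrite -starmulDr !GRing.subrr star_mulr0.
Qed.

(** The equation [p = p * star p] also encodes self-adjointness, since its right
    side is invariant under [star]. *)
Lemma projection_idem p : projection p -> p = (p * p)%g.
Proof.
move=> Pp; have sp : star p = p by rewrite Pp starM starK.
by move: Pp; rewrite /projection /= sp.
Qed.

Lemma preceq_subperp a b : a ⪯ b -> subperp a b.
Proof. by move=> [y _ <-] x bx0; rewrite /perp -mulgA bx0 star_mulr0. Qed.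

Lemma ll_preceq_trans a b c : c ≪ b -> b ⪯ a -> c ⪯ a.
Proof. by move=> cb [x _ xab]; exists (c * x)%g => //; rewrite -mulgA xab -cb. Qed.

Lemma left_multiples_neq0 a :
  left_multiples a <> [set 0] <-> exists2 b, b <> 0 & b ⪯ a.
Proof.
split=> [Aa0|[b b0 ba] Aa0]; last by apply: b0; move: ba; rewrite /preceq Aa0.
apply: contrapT => nb; apply: Aa0; apply/seteqP; split=> [b ba|_ ->].
  by apply: contrapT => b0; apply: nb; exists b.
by exists 0 => //; rewrite star_mul0r.
Qed.

(** Reflexivity of [subperp] makes the existence hypothesis of coinitiality
    automatic. *)
Lemma Blackadar_subperpP a : Blackadar (@subperp A) -> a <> 0 ->
  exists2 p, (@projection A `\ 0) p & subperp p a.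
Proof. by move=> BA a0; apply: BA => //; exists a. Qed.

Lemma right_faithful a :
  Blackadar (@subperp A) -> (forall x, perp a x) -> a = 0.
Proof.
move=> BA aA0; apply: contrapT => /(Blackadar_subperpP a BA)[p [Pp p0] pa].
by apply: p0; rewrite (projection_idem _ Pp); apply: pa.
Qed.

Lemma Blackadar_preceq_subperp :
  (forall a, a <> 0 -> left_multiples a <> [set 0]) ->
  Blackadar (@preceq A) -> Blackadar (@subperp A).
Proof.
move=> Aa0 BA a a0 _.
have [p Pp pa] := BA a a0 (proj1 (left_multiples_neq0 a) (Aa0 a a0)).
by exists p => //; apply: preceq_subperp.
Qed.

Lemma Blackadar_subperp_ll : Blackadar (@subperp A) -> Blackadar (@ll A).
Proof.
move=> BA a _ [b b0 ba].
have [p Pp pb] := Blackadar_subperpP b BA b0.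
exists p => //; apply: GRing.subr0_eq; apply: (right_faithful _ BA) => x.
rewrite /perp starmulDl star_mulNr -mulgA -star_mulrN -starmulDr.
by apply: pb; rewrite /perp starmulDr star_mulrN mulgA -ba GRing.subrr.
Qed.

Lemma Blackadar_ll_preceq :
  (forall a, a <> 0 -> exists b c, [/\ c <> 0, c ≪ b & b ⪯ a]) ->
  Blackadar (@ll A) ->
  (forall a, a <> 0 -> left_multiples a <> [set 0]) /\ Blackadar (@preceq A).
Proof.
move=> below BA; split=> [a a0|a a0 _].
  have [b [c [c0 cb ba]]] := below a a0.
  by apply/left_multiples_neq0; exists c => //; apply: ll_preceq_trans ba.
have [b [c [c0 cb ba]]] := below a a0.
have b0 : b <> 0 by move=> b0; apply: c0; rewrite cb b0 star_mulr0.
have [p Pp pb] : exists2 p, (@projection A `\ 0) p & p ≪ b.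
  by apply: BA => //; exists c.
by exists p => //; apply: ll_preceq_trans ba.
Qed.

End StarRingTheory.

Theorem mainTheorem9 (A : starRingType) :
  [/\ (forall a : A, a <> 0 -> left_multiples a <> [set 0]) /\
        Blackadar (@preceq A) -> Blackadar (@subperp A),
      Blackadar (@subperp A) -> Blackadar (@ll A)
    & (forall a : A, a <> 0 -> exists b c : A, [/\ c <> 0, c ≪ b & b ⪯ a]) ->
      [/\ ((forall a : A, a <> 0 -> left_multiples a <> [set 0]) /\
             Blackadar (@preceq A)) <-> Blackadar (@subperp A),
          Blackadar (@subperp A) <-> Blackadar (@ll A)
        & ((forall a : A, a <> 0 -> left_multiples a <> [set 0]) /\
             Blackadar (@preceq A)) <-> Blackadar (@ll A)]].
Proof.
have pq : (forall a : A, a <> 0 -> left_multiples a <> [set 0]) /\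
    Blackadar (@preceq A) -> Blackadar (@subperp A).
  by case; apply: (Blackadar_preceq_subperp A).
have ql := Blackadar_subperp_ll A.
split=> // /(Blackadar_ll_preceq A) lp.
by split; split=> //; [move/ql/lp | move/lp/pq | move/pq/ql].
Qed.
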